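(* Let $K$ be a field with algebraic closure $\bar{K}$, and let $G:K^n\to K^n$ be a square matrix of any finite size $n$ with entries in $K$. Let $\lambda_1,\dots,\lambda_m\in\bar{K}$ be the distinct eigenvalues of $G$, and let $p_1,\dots,p_m\in\mathbb{N}$ be their respective (algebraic) multiplicities. Let $t\ge 1$ and $l\ge 0$ be integers, and let $M_{t,l}=M_{t,l}(G)$ be the $t\times t$ matrix with entries $[M_{t,l}(G)]_i^j=\operatorname{tr} G^{i+j+l-2}$, $1\le i,j\le t$. Then: 1. If $t>m$, then $\det M_{t,l}=0$. 2. For a nonempty subset $T=\{i_1<\cdots<i_t\}\subset\{1,\dots,m\}$ of cardinality $t$ set $p(T)=p_{i_1}\cdots p_{i_t}$ and $\lambda(T)=\lambda_{i_1}\cdots\lambda_{i_t}$. Then for $t\le m$, $$ \det M_{t,l}=\sum_{T=\{i_1<\cdots<i_t\}\subset\{1,\dots,m\},\ |T|=t}p(T)\,(\lambda(T))^l\,\bigl(\det V(\lambda_{i_1},\dots,\lambda_{i_t})\bigr)^2 . $$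
   Context: $[A]_i^j$ denotes the entry of the matrix $A$ in row $i$ and column $j$; $\operatorname{tr}$ is the trace; $G^0$ is the identity matrix, and $z^0=1$ for every scalar $z$ (including $z=0$). The multiplicity of an eigenvalue $\lambda\in\bar K$ of $G$ always means its algebraic multiplicity. Positive integers such as $p_i$ appearing in formulas over $\bar K$ are understood via their images in $\bar K$. For $z_1,\dots,z_t\in\bar K$, $V(z_1,\dots,z_t)$ is the $t\times t$ Vandermonde matrix whose entry in row $i$ and column $j$ is $z_j^{i-1}$, $1\le i,j\le t$. *)

(* Defs.v *)
From mathcomp Require Import all_boot all_order all_algebra.

Set Implicit Arguments.
Unset Strict Implicit.
Unset Printing Implicit Defensive.

Import GRing.Theory.
Local Open Scope ring_scope.

(* With the 0-based indices of 'I_t, the exponent i + j + l - 2 for           *)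
(* 1 <= i, j <= t reads i + j + l.                                            *)
Definition trace_power_mx (R : pzRingType) (n t l : nat) (G : 'M[R]_n) :
    'M[R]_t :=
  \matrix_(i < t, j < t) \tr (G ^+ (i + j + l)).

Definition alg_multiplicity (F : fieldType) (n : nat) (A : 'M[F]_n) (a : F) :
    nat :=
  mup a (char_poly A).

(* enum_val lists T in increasing order, so its columns are                   *)
(* lambda_(i_1), ..., lambda_(i_t) for T = {i_1 < ... < i_t}.                 *)
Definition Vandermonde_on (R : pzRingType) (m : nat) (lambda : 'I_m -> R)
    (T : {set 'I_m}) : 'M[R]_#|T| :=
  Vandermonde #|T| (\row_(j < #|T|) lambda (enum_val j)).

(* Main.v *)
Require Import Defs.
From mathcomp Require Import all_boot all_order all_fingroup all_algebra.
Set Implicit Arguments.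
Unset Strict Implicit.
Unset Printing Implicit Defensive.
Import GRing.Theory.
Local Open Scope ring_scope.

(** Over the algebraic closure G is similar to a block triangular matrix with
    an eigenvalue in the corner, so by induction on n the characteristic
    polynomial of G splits and the trace of G ^+ k is the sum of the k-th powers
    of its roots ([eigenvalue_seqP]).  Grouping equal roots, each lambda i
    occurs p i times, so
      tr (G ^+ (i + j + l)) = sum_k lambda_k^i * (p_k lambda_k^l) * lambda_k^j,
    which is the matrix factorization M = V D V^T with V the rectangular t x m
    Vandermonde matrix and D = diag (p_k lambda_k^l) ([trace_power_mx_factor]).

    The Cauchy-Binet formula ([Cauchy_Binet]) expands det (V D V^T) as a sum
    over the t-subsets T of the eigenvalue indices; the term of T is the square
    of the Vandermonde determinant of T times the product of the diagonal
    entries of D in T, which is p(T) lambda(T)^l.  When t > m there is no such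
    T, so the determinant is zero in the closure, hence in K because a field
    morphism is injective. *)

(** * Traces of powers as power sums of eigenvalues *)

(** Similarity is phrased as P *m A = B *m P, free of inverses, so that it can
    be pushed through polynomial coefficients: det P is a nonzero constant
    polynomial and cancels. *)
Lemma char_poly_intertwine (F : fieldType) (n : nat) (P A B : 'M[F]_n) :
  P \in unitmx -> P *m A = B *m P -> char_poly A = char_poly B.
Proof.
move=> Pu PAB; have dP : (\det P)%:P != 0 :> {poly F}.
  by rewrite polyC_eq0 -unitfE -unitmxE.
apply: (mulfI dP); rewrite -det_map_mx [RHS]mulrC -!det_mulmx; congr (\det _).
rewrite /char_poly_mx mulmxBr mulmxBl -!map_mxM PAB.
by rewrite mul_mx_scalar mul_scalar_mx.
Qed.

Lemma mxtrace_exp_intertwine (F : fieldType) (n : nat) (P A B : 'M[F]_n) k :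
  P \in unitmx -> P *m A = B *m P -> \tr (A ^+ k) = \tr (B ^+ k).
Proof.
move=> Pu PAB; suff PABk : P *m A ^+ k = B ^+ k *m P.
  by rewrite -[A ^+ k](mulKmx Pu) PABk mxtrace_mulC mulmxK.
elim: k => [|k IHk]; first by rewrite !expr0 mulmx1 mul1mx.
rewrite !exprS.
(* The ring product of square matrices is mulmx only up to conversion. *)
have -> : A * A ^+ k = A *m A ^+ k by [].
have -> : B * B ^+ k = B *m B ^+ k by [].
by rewrite mulmxA PAB -!mulmxA IHk.
Qed.

(** The one reduction step of triangularization: complete a (row) eigenvector
    to a basis.  Since eigenvectors act on the left, the zero block is in the
    upper right corner. *)
Lemma eigenvector_block (F : fieldType) (n : nat) (A : 'M[F]_(1 + n)) a :
  eigenvalue A a -> exists2 P : 'M[F]_(1 + n), P \in unitmx &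
  exists c B, P *m A = (block_mx a%:M 0 c B : 'M_(1 + n)) *m P.
Proof.
move=> /eigenvalueP[v vA v0].
pose e := delta_mx 0 0 : 'rV[F]_(1 + n).
have eg : e *m (\matrix_(i < 1 + n) v) = v.
  by rewrite -rowE rowK.
(* An invertible P whose first row is the eigenvector v. *)
have [|P Pu eP] := @complete_unitmx _ _ _ e (\matrix_(i < 1 + n) v).
  by rewrite eg rank_rV v0 mxrank_delta.
exists P => //.
have [Q rQ ->] : exists2 Q : 'M_(1 + n),
    row 0 Q = a *: e & P *m A = Q *m P.
  exists (P *m A *m invmx P); last by rewrite mulmxKV.
  by rewrite rowE !mulmxA -/e -eP eg vA -scalemxAl -eg eP mulmxK.
have Q0 j : Q 0 j = a *+ (j == 0).
  by have /rowP/(_ j) := rQ; rewrite !mxE => ->; rewrite mulr_natr.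
exists (dlsubmx Q), (drsubmx Q); congr (_ *m P); rewrite -[LHS]submxK.
congr (block_mx _ _ _ _); apply/matrixP=> i j.
all: by rewrite (ord1 i) !mxE lshift0 Q0 ?ord1.
Qed.

Lemma mxtrace_exp_lblock (R : comPzRingType) n1 n2
    (A : 'M[R]_n1) C (B : 'M[R]_n2) k :
  \tr ((block_mx A 0 C B : 'M_(n1 + n2)) ^+ k) = \tr (A ^+ k) + \tr (B ^+ k).
Proof.
suff [D ->] : exists D,
    (block_mx A 0 C B : 'M_(n1 + n2)) ^+ k = block_mx (A ^+ k) 0 D (B ^+ k).
  exact: mxtrace_block.
elim: k => [|k [D IHk]].
  by exists 0; rewrite !expr0; apply: scalar_mx_block.
exists (C *m A ^+ k + B *m D); rewrite !exprS IHk.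
rewrite [LHS](_ : _ = block_mx A 0 C B *m block_mx (A ^+ k) 0 D (B ^+ k)) //.
by rewrite mulmx_block !mulmx0 !mul0mx !addr0 !add0r.
Qed.

Lemma char_poly_lblock (R : comNzRingType) n1 n2
    (A : 'M[R]_n1) C (B : 'M[R]_n2) :
  char_poly (block_mx A 0 C B) = char_poly A * char_poly B.
Proof.
rewrite /char_poly -(det_lblock (char_poly_mx A) (- map_mx polyC C)).
congr (\det _); rewrite /char_poly_mx map_block_mx /= map_mx0 scalar_mx_block.
by rewrite opp_block_mx add_block_mx !oppr0 !addr0 add0r.
Qed.

(** One induction must give both conclusions: it is what guarantees that the
    elements whose powers sum to the traces are the roots of the characteristic
    polynomial with the right multiplicities. *)
Lemma eigenvalue_seqP (F : closedFieldType) (n : nat) (A : 'M[F]_n) :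
  exists2 s : seq F, char_poly A = \prod_(x <- s) ('X - x%:P) &
    forall k, \tr (A ^+ k) = \sum_(x <- s) x ^+ k.
Proof.
elim: n A => [|n IHn] A.
  exists [::] => [|k]; first by rewrite big_nil /char_poly det_mx00.
  by rewrite big_nil /mxtrace big_ord0.
have /closed_rootP[a] : size (char_poly A) != 1 by rewrite size_char_poly.
rewrite -eigenvalue_root_char => /eigenvector_block[P Pu [c [B PA]]].
have [s sE sT] := IHn B; exists (a :: s) => [|k].
  rewrite (char_poly_intertwine Pu PA) char_poly_lblock sE big_cons.
  by rewrite /char_poly /char_poly_mx det_mx11 !mxE.
rewrite (mxtrace_exp_intertwine k Pu PA) mxtrace_exp_lblock sT big_cons.
congr (_ + _); have -> : (a%:M : 'M_1) ^+ k = (a ^+ k)%:M by rewrite rmorphXn.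
exact: mxtrace_scalar.
Qed.

Lemma mup_prod_XsubC (F : fieldType) (s : seq F) (x : F) :
  mup x (\prod_(y <- s) ('X - y%:P)) = count_mem x s.
Proof.
elim: s => [|y s IHs]; first by rewrite big_nil mupNroot // root1.
rewrite big_cons mupM ?polyXsubC_eq0 //=; last first.
  by rewrite monic_neq0 // monic_prod_XsubC.
by rewrite IHs -['X - _]expr1 mup_XsubCX; case: eqP.
Qed.

(** Grouping equal terms of the list of eigenvalues turns the power sum into a
    sum over the distinct eigenvalues, weighted by multiplicity. *)
Lemma mxtrace_exp_multiplicity (F : closedFieldType) (n m : nat) (A : 'M[F]_n)
    (lambda : 'I_m -> F) (k : nat) :
  injective lambda ->
  (forall x, eigenvalue A x -> exists i, x = lambda i) ->
  \tr (A ^+ k) = \sum_i (alg_multiplicity A (lambda i))%:R * lambda i ^+ k.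
Proof.
move=> lam_inj lamP; have [s sE ->] := eigenvalue_seqP A.
have s_lam x : x \in s -> exists i, x = lambda i.
  by move=> xs; apply: lamP; rewrite eigenvalue_root_char sE root_prod_XsubC.
rewrite /alg_multiplicity sE.
under [RHS]eq_bigr do rewrite mup_prod_XsubC.
elim: s {sE} s_lam => [|x s IHs] s_lam.
  by rewrite big_nil big1 // => i _; rewrite mul0r.
rewrite big_cons IHs; last by move=> y ys; apply: s_lam; rewrite inE ys orbT.
have [i0 ->] := s_lam x (mem_head _ _).
under [RHS]eq_bigr do rewrite /= natrD mulrDl.
rewrite big_split /=; congr (_ + _).
rewrite (bigD1 i0) //= eqxx mul1r big1 ?addr0 //.
by move=> i /negPf; rewrite (inj_eq lam_inj) eq_sym => ->; rewrite mul0r.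
Qed.

(** * The Cauchy-Binet formula *)

(** An injective function from 'I_t is an ordering of its image, and two
    orderings of the same set differ by a permutation. *)
Lemma eq_imset_perm (m t : nat) (f h : 'I_t -> 'I_m) :
  injective f -> injective h -> f @: setT = h @: setT ->
  exists s : 'S_t, f =1 h \o s.
Proof.
move=> f_inj h_inj fh.
have fP i : exists j, f i == h j.
  have : f i \in h @: setT by rewrite -fh imset_f.
  by case/imsetP=> j _ ->; exists j.
pose s i := xchoose (fP i).
have sP i : f i = h (s i) by apply/eqP/(xchooseP (fP i)).
have s_inj : injective s by move=> i j sij; apply: f_inj; rewrite !sP sij.
by exists (perm s_inj) => i /=; rewrite permE sP.
Qed.

Lemma imset_enum_val (I : finType) (T : {set I}) :
  (@enum_val I (mem T)) @: setT = T.
Proof.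
apply/setP=> x; apply/imsetP/idP => [[i _ ->]|xT]; first exact: enum_valP.
by exists (enum_rank_in xT x) => //; rewrite enum_rankK_in.
Qed.

(** The term attached to a t-subset T is the product of the T-minors of A and B.
    Listing T in another order multiplies both minors by the same sign, so the
    product depends on T only; g stands for that product, and is specified on
    all orderings h of T.  This avoids any cast between 'I_#|T| and 'I_t.

    The proof expands the determinant by multilinearity over all functions f
    from rows of A to columns of A.  A non-injective f repeats a row of B and
    contributes nothing; the injective ones are grouped by their image T, where
    they are the h \o s for s a permutation, and the sum over s of the signed
    products is the minor of A. *)
Lemma Cauchy_Binet (R : comPzRingType) (t m : nat)
    (A : 'M[R]_(t, m)) (B : 'M[R]_(m, t)) (g : {set 'I_m} -> R) :
  (forall h : 'I_t -> 'I_m, injective h ->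
     g (h @: setT) = \det (colsub h A) * \det (rowsub h B)) ->
  \det (A *m B) = \sum_(T : {set 'I_m} | #|T| == t) g T.
Proof.
move=> gE.
transitivity (\sum_(f : {ffun 'I_t -> 'I_m})
                 (\prod_i A i (f i)) * \det (rowsub f B)).
  pose AB (s : 'S_t) i j := A i j * B j (s i).
  transitivity (\sum_(f : {ffun 'I_t -> 'I_m}) \sum_(s : 'S_t)
                  (-1) ^+ s * \prod_i AB s i (f i)).
    rewrite exchange_big; apply: eq_bigr => /= s _; rewrite -big_distrr /=.
    congr (_ * _); rewrite -(bigA_distr_bigA (AB s)) /=.
    by apply: eq_bigr => i _; rewrite mxE.
  apply: eq_bigr => f _; rewrite big_distrr /=; apply: eq_bigr => s _.
  rewrite big_split /= mulrCA; congr (_ * (_ * _)).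
  by apply: eq_bigr => i _; rewrite mxE.
rewrite (bigID (fun f : {ffun 'I_t -> 'I_m} => injectiveb f)) /=.
rewrite addrC big1 ?add0r => [|f]; last first.
  case/injectivePn=> i [j ij fij].
  by rewrite (determinant_alternate ij) ?mulr0 // => k; rewrite !mxE fij.
rewrite (partition_big (fun f : {ffun 'I_t -> 'I_m} => f @: setT)
   (fun T : {set 'I_m} => #|T| == t)) /=; last first.
  by move=> f /injectiveP fi; rewrite card_imset // cardsT card_ord.
apply: eq_bigr => T /eqP Tt.
have [h h_inj <-] : exists2 h : 'I_t -> 'I_m, injective h & h @: setT = T.
  subst t; exists enum_val; [exact: enum_val_inj | exact: imset_enum_val].
rewrite gE //.
pose hs (s : 'S_t) := [ffun i => h (s i)] : {ffun 'I_t -> 'I_m}.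
rewrite (reindex hs) /=; last first.
  have hf (f : {ffun 'I_t -> 'I_m}) :
      injectiveb f && (f @: setT == h @: setT) -> exists s, f == hs s.
    case/andP=> /injectiveP f_inj /eqP fh.
    have [s fs] := eq_imset_perm f_inj h_inj fh.
    by exists s; apply/eqP/ffunP=> i; rewrite ffunE fs.
  have hs_inj : injective hs.
    move=> s s' /ffunP ss'; apply/permP=> i; apply: h_inj.
    by have := ss' i; rewrite !ffunE.
  pose hs_inv (f : {ffun 'I_t -> 'I_m}) := odflt 1%g [pick s | f == hs s].
  exists hs_inv => [s _|f /hf[s fs]]; rewrite /hs_inv /=.
    by case: pickP => [s' /eqP/hs_inj //|/(_ s)]; rewrite eqxx.
  by case: pickP => [s' /eqP //|/(_ s)]; rewrite fs.
rewrite big_distrl /=; apply: eq_big => [s|s _].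
  apply/andP; split.
    by apply/injectiveP=> i j; rewrite !ffunE => /h_inj/perm_inj.
  apply/eqP/setP=> x; apply/imsetP/imsetP=> -[i _ ->].
    by exists (s i); rewrite ?ffunE.
  by exists (s^-1%g i); rewrite ?ffunE ?permKV.
have -> : rowsub (hs s) B = row_perm s (rowsub h B).
  by apply/matrixP=> i j; rewrite !mxE ffunE.
rewrite row_permE det_mulmx det_perm mulrCA mulrA; congr (_ * _ * _).
by apply: eq_bigr => i _; rewrite !mxE ffunE.
Qed.

(** * Hankel matrices of traces *)

(** The square removes the sign of the permutation relating h to the increasing
    enumeration. *)
Lemma det_Vandermonde_on_sqr (R : comPzRingType) (m t : nat)
    (lambda : 'I_m -> R) (h : 'I_t -> 'I_m) : injective h ->
  \det (Vandermonde_on lambda (h @: setT)) ^+ 2 =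
  \det (Vandermonde t (\row_j lambda (h j))) ^+ 2.
Proof.
move=> h_inj; rewrite /Vandermonde_on; move eT: (h @: setT) => T.
have tT : t = #|T| by rewrite -eT card_imset // cardsT card_ord.
(* Substituting t makes both Vandermonde matrices of the same type. *)
subst t.
have [s hs] : exists s : 'S_#|T|, h =1 enum_val \o s.
  apply: eq_imset_perm => //; first exact: enum_val_inj.
  by rewrite eT imset_enum_val.
rewrite (_ : Vandermonde _ (\row_j lambda (h j)) = col_perm s
   (Vandermonde #|T| (\row_(j < #|T|) lambda (enum_val j)))); last first.
  by apply/matrixP=> i j; rewrite !mxE hs.
by rewrite col_permE det_mulmx det_perm exprMn sqrr_sign mulr1.
Qed.

Lemma trace_power_mx_factor (F : closedFieldType) (n m t l : nat) (A : 'M[F]_n)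
    (lambda : 'I_m -> F) :
  injective lambda -> (forall x, eigenvalue A x -> exists i, x = lambda i) ->
  trace_power_mx t l A =
    Vandermonde t (\row_i lambda i)
    *m diag_mx (\row_i ((alg_multiplicity A (lambda i))%:R * lambda i ^+ l))
    *m (Vandermonde t (\row_i lambda i))^T.
Proof.
move=> lam_inj lamP; apply/matrixP=> i j.
rewrite mul_mx_diag !mxE (mxtrace_exp_multiplicity _ lam_inj lamP).
apply: eq_bigr => k _; rewrite !mxE !exprD.
by rewrite [RHS]mulrAC [RHS]mulrCA.
Qed.

(** Cauchy-Binet is applied to the product of V D and V^T: for an ordering h of
    T, the T-minor of V D is that of V times the entries of D along h. *)
Lemma det_trace_power_mx (F : closedFieldType) (n m t l : nat) (A : 'M[F]_n)
    (lambda : 'I_m -> F) :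
  injective lambda -> (forall x, eigenvalue A x -> exists i, x = lambda i) ->
  \det (trace_power_mx t l A) =
    \sum_(T : {set 'I_m} | #|T| == t)
      (\prod_(i in T) alg_multiplicity A (lambda i))%:R
      * (\prod_(i in T) lambda i) ^+ l * \det (Vandermonde_on lambda T) ^+ 2.
Proof.
move=> lam_inj lamP; rewrite (trace_power_mx_factor t l lam_inj lamP).
apply: Cauchy_Binet => h h_inj.
have prod_h (f : 'I_m -> F) : \prod_(i in h @: setT) f i = \prod_i f (h i).
  rewrite big_imset; last by move=> i j _ _ /h_inj.
  by apply: eq_bigl => i; rewrite inE.
rewrite det_Vandermonde_on_sqr // natr_prod !prod_h -prodrXl -big_split /=.
set V := Vandermonde t (\row_j lambda (h j)).
have -> : rowsub h (Vandermonde t (\row_i lambda i))^T = V^T.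
  by apply/matrixP=> i j; rewrite !mxE.
rewrite mul_mx_diag; set d := fun i : 'I_m => _%:R * _.
have -> : colsub h (\matrix_(i, j) (Vandermonde t (\row_k lambda k) i j
                                   * (\row_k d k) 0 j)) =
  V *m diag_mx (\row_j d (h j)).
  by rewrite mul_mx_diag; apply/matrixP=> i j; rewrite !mxE.
rewrite det_mulmx det_diag det_tr mulrAC -expr2 mulrC; congr (_ * _).
by apply: eq_bigr => i _; rewrite mxE.
Qed.

Theorem theorem1
    (K : fieldType) (Kbar : closedFieldType) (iota : {rmorphism K -> Kbar})
    (Kbar_alg : forall x : Kbar, algebraicOver iota x)
    (n : nat) (G : 'M[K]_n)
    (m : nat) (lambda : 'I_m -> Kbar) (p : 'I_m -> nat)
    (lambda_inj : injective lambda)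
    (lambdaP : forall x : Kbar,
       eigenvalue (map_mx iota G) x <-> exists i : 'I_m, x = lambda i)
    (pE : forall i : 'I_m, p i = alg_multiplicity (map_mx iota G) (lambda i))
    (t l : nat) (t_gt0 : (1 <= t)%N) :
  ((m < t)%N -> \det (trace_power_mx t l G) = 0) /\
  ((t <= m)%N ->
     iota (\det (trace_power_mx t l G)) =
       \sum_(T : {set 'I_m} | #|T| == t)
          (\prod_(i in T) p i)%:R * (\prod_(i in T) lambda i) ^+ l
          * (\det (Vandermonde_on lambda T)) ^+ 2).
Proof.
have detE : iota (\det (trace_power_mx t l G)) =
    \sum_(T : {set 'I_m} | #|T| == t)
      (\prod_(i in T) p i)%:R * (\prod_(i in T) lambda i) ^+ l
      * (\det (Vandermonde_on lambda T)) ^+ 2.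
  under eq_bigr do under eq_bigr do rewrite pE.
  rewrite -det_trace_power_mx //; last by move=> x /lambdaP.
  rewrite -det_map_mx; congr (\det _); apply/matrixP=> i j.
  by rewrite !mxE -trace_map_mx rmorphXn.
split=> // lt_mt; apply/eqP; rewrite -(fmorph_eq0 iota) detE big_pred0 // => T.
by apply/negbTE; rewrite neq_ltn (leq_ltn_trans (max_card _)) ?card_ord.
Qed.
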